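(* For all integers $n, k \geq 2$, we have $r\big(C_{kn}^{(k)}\big) \geq (k+1)n - 1$.
   Context: A $k$-graph $H$ is a pair $(V(H),E(H))$ with $E(H)\subseteq \binom{V(H)}{k}$, where $\binom{S}{k}$ is the set of all $k$-element subsets of $S$. $K_N^{(k)}$ is the complete $k$-graph on $N$ vertices. The $k$-uniform tight cycle $C_m^{(k)}$ is the $k$-graph on $m$ vertices with a cyclic ordering of its vertices such that its edges are precisely the sets of $k$ consecutive vertices in that ordering. The (2-colour) Ramsey number $r(H)$ of a $k$-graph $H$ is the smallest integer $N$ such that any colouring of the edges of $K_N^{(k)}$ with two colours (red and blue) contains a monochromatic copy of $H$. *)

(* Defs.v *)
From mathcomp Require Import all_boot.

Set Implicit Arguments.
Unset Strict Implicit.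
Unset Printing Implicit Defensive.

Record kgraph (k : nat) := KGraph {
  vertex :> finType;
  edges : {set {set vertex}};
  edges_uniform : forall e, e \in edges -> #|e| = k
}.

Section KGraphs.
Variable k : nat.

Fact complete_uniform N (e : {set 'I_N}) :
  e \in [set e : {set 'I_N} | #|e| == k] -> #|e| = k.
Proof. by rewrite inE => /eqP. Qed.

Definition complete N : kgraph k := KGraph (@complete_uniform N).

(* [i + t] is reduced modulo m: these are the k vertices following i (included)
   in the cyclic ordering 0, 1, ..., m - 1. *)
Definition consecutive m (i : 'I_m) : {set 'I_m} :=
  [set j | [exists t : 'I_k, val j == (i + t) %% m]].

Lemma card_consecutive m (i : 'I_m) : k <= m -> #|consecutive i| = k.
Proof.
move=> lekm; have m_gt0 : 0 < m := leq_ltn_trans (leq0n i) (ltn_ord i).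
pose g (t : 'I_k) := Ordinal (ltn_pmod (i + t) m_gt0).
have g_inj : injective g.
  move=> s t /(congr1 val) /= /eqP; rewrite eqn_modDl => /eqP.
  by rewrite !modn_small ?(leq_trans (ltn_ord _)) // => /val_inj.
rewrite -[RHS]card_ord -(card_imset 'I_k g_inj); apply: eq_card => j; rewrite inE.
apply/existsP/imsetP => [[t /eqP jE] | [t _ ->]]; exists t => //=.
exact: val_inj.
Qed.

Fact tight_cycle_uniform m (e : {set 'I_m}) :
  e \in [set e : {set 'I_m} |
          (#|e| == k) && [exists i, e == consecutive i]] -> #|e| = k.
Proof. by rewrite inE => /andP[/eqP]. Qed.

(* The size condition is automatic for k <= m (card_consecutive); for m < k
   there are no k consecutive vertices, hence no edge. *)
Definition tight_cycle m : kgraph k := KGraph (@tight_cycle_uniform m).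

Definition has_copy (H G : kgraph k) : bool :=
  [exists f : {ffun H -> G},
    injectiveb f && [forall e in edges H, f @: e \in edges G]].

Fact colour_class_uniform (G : kgraph k) (c : {ffun {set G} -> bool}) b e :
  e \in [set e in edges G | c e == b] -> #|e| = k.
Proof. by rewrite inE => /andP[/edges_uniform]. Qed.

(* A colouring is defined on all sets of vertices, but only its values on the
   edges of G matter: the two colour classes partition edges G. *)
Definition colour_class (G : kgraph k) (c : {ffun {set G} -> bool}) b :
  kgraph k := KGraph (@colour_class_uniform G c b).

Definition arrows (N : nat) (H : kgraph k) : bool :=
  [forall c : {ffun {set complete N} -> bool},
    [exists b, has_copy H (colour_class c b)]].

End KGraphs.

Definition homogeneous (T : finType) k (c : {set T} -> bool) b (B : {set T}) :=
  forall e : {set T}, e \subset B -> #|e| = k -> c e = b.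

Lemma homogeneousU1 (T : finType) k (c : {set T} -> bool) b x (B S : {set T}) :
  homogeneous k (fun e => c (x |: e)) b B -> S \subset B ->
  homogeneous k.+1 c b S -> homogeneous k.+1 c b (x |: S).
Proof.
move=> hB sSB hS e; rewrite -subDset => seS ce.
have [xe | xNe] := boolP (x \in e).
  rewrite -(setD1K xe); apply: hB; first exact: subset_trans sSB.
  by move: ce; rewrite (cardsD1 x) xe => -[].
by apply: hS => //; rewrite (setDidPl _) // disjoint_sym disjoints1 in seS.
Qed.

Lemma subset_card (T : finType) (A : {set T}) s :
  s <= #|A| -> exists2 B : {set T}, B \subset A & #|B| = s.
Proof.
move=> leA; exists [set x in take s (enum A)].
  by apply/subsetP => x; rewrite inE => /mem_take; rewrite mem_enum.
rewrite cardsE; move/card_uniqP: (take_uniq s (enum_uniq A)) => ->.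
by rewrite size_takel // -cardE.
Qed.

Theorem finite_ramsey k s t : exists N, forall (T : finType) (A : {set T})
    (c : {set T} -> bool), N <= #|A| ->
  exists (B : {set T}) (b : bool),
    [/\ B \subset A, #|B| = (if b then s else t) & homogeneous k c b B].
Proof.
elim: k s t => [|k IHk] s t.
  exists (maxn s t) => T A c; rewrite geq_max => /andP[leS leT].
  have [|B sBA cB] := @subset_card T A (if c set0 then s else t).
    by case: (c set0).
  by exists B, (c set0); split=> // e _ /eqP; rewrite cards_eq0 => /eqP ->.
elim: s t => [|s IHs] t.
  exists 0 => T A c _; exists set0, true; rewrite sub0set cards0; split=> // e.
  by rewrite subset0 => /eqP ->; rewrite cards0.
elim: t => [|t [N2 IHt]].
  exists 0 => T A c _; exists set0, false; rewrite sub0set cards0; split=> // e.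
  by rewrite subset0 => /eqP ->; rewrite cards0.
have [N1 {}IHs] := IHs t.+1; have [N IH] := IHk N1 N2.
exists N.+1 => T A c ltNA.
have /card_gt0P[x xA] : 0 < #|A| by apply: leq_trans ltNA.
have [|B [b [sBA cB hB]]] := IH T (A :\ x) (fun e => c (x |: e)).
  by move: ltNA; rewrite (cardsD1 x) xA.
have [{}sBA xNB] : B \subset A /\ x \notin B by apply/andP; rewrite -subsetD1.
have ext (S : {set T}) : S \subset B -> homogeneous k.+1 c b S ->
    [/\ x |: S \subset A, #|x |: S| = #|S|.+1 & homogeneous k.+1 c b (x |: S)].
  move=> sSB hS; split; last exact: homogeneousU1 hB sSB hS.
    by rewrite subUset sub1set xA (subset_trans sSB).
  by rewrite cardsU1 (contra (subsetP sSB x) xNB).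
have [S [b' [sSB cS hS]]] : exists (S : {set T}) (b' : bool),
    [/\ S \subset B, #|S| = (if b' then (if b then s else s.+1)
                             else (if b then t.+1 else t))
      & homogeneous k.+1 c b' S].
  by case: (b) cB => cB; [apply: IHs | apply: IHt]; rewrite cB.
have sSA := subset_trans sSB sBA.
have [eb | nb] := eqVneq b' b.
  rewrite eb in cS hS; have [sA cx hx] := ext S sSB hS.
  by exists (x |: S), b; split=> //; rewrite cx cS; case: (b).
by exists S, b'; split=> //; rewrite cS; case: (b) (b') nb => [] [].
Qed.

Lemma ramsey_exists k (H : kgraph k) : exists N, arrows N H.
Proof.
have [N rN] := finite_ramsey k #|H| #|H|; exists N.
apply/forallP => c; have [|B [b [_ cB hB]]] := rN _ [set: complete k N] c.
  by rewrite cardsT card_ord.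
have {}cB : #|B| = #|H| by rewrite cB if_same.
apply/existsP; exists b; apply/existsP.
pose f (v : H) := enum_val (cast_ord (esym cB) (enum_rank v)).
have f_inj : injective f.
  by move=> u v /enum_val_inj /cast_ord_inj /enum_rank_inj.
exists [ffun v => f v]; apply/andP; split.
  by apply/injectiveP => u v; rewrite !ffunE => /f_inj.
apply/forall_inP => e eH; have -> : [ffun v => f v] @: e = f @: e.
  by apply: eq_imset => v; rewrite ffunE.
have ce : #|f @: e| = k by rewrite card_imset // (edges_uniform eH).
rewrite !inE ce eqxx /=; apply/eqP/hB => //.
by apply/subsetP => _ /imsetP[v _ ->]; apply: enum_valP.
Qed.

Definition ramsey k (H : kgraph k) : nat := ex_minn (ramsey_exists H).

(* Main.v *)
Require Import Defs.
From mathcomp Require Import all_boot.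

(** Take fewer than [(k + 1) * n - 1] vertices, let the core [A] consist of
    [k * n - 1] of them (or of all of them, if there are fewer), and colour a
    [k]-set by whether it leaves [A]. Since every vertex of the tight cycle lies
    in an edge, a copy in the colour of the sets inside [A] would place all
    [k * n] of its vertices in [A], which is one too many. In the other colour,
    the vertices outside [A] would meet every edge of the copy; but the cycle
    splits into [n] pairwise disjoint edges (its consecutive blocks of length
    [k], lemma [tight_cycle_transversal]), so [n] vertices outside [A] would be
    needed and at most [n - 1] are there. *)

Lemma mem_consecutive {k m} (i : 'I_m) : 0 < k -> i \in consecutive k i.
Proof.
move=> k_gt0; rewrite inE; apply/existsP; exists (Ordinal k_gt0).
by rewrite /= addn0 modn_small.
Qed.

Lemma consecutive_edge {k m} (i : 'I_m) :
  k <= m -> consecutive k i \in edges (tight_cycle k m).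
Proof.
by move=> lekm; rewrite inE card_consecutive // eqxx; apply/existsP; exists i.
Qed.

(** The [n] edges starting at the multiples of [k] are the fibres of [v %/ k],
    so a set that meets all of them is mapped onto [{0, ..., n - 1}]. *)
Lemma tight_cycle_transversal {k n} {T : {set 'I_(k * n)}} : 0 < k ->
  (forall i : 'I_(k * n), exists2 v, v \in consecutive k i & v \in T) ->
  n <= #|T|.
Proof.
move=> k_gt0 meetT.
have div_lt (v : 'I_(k * n)) : v %/ k < n by rewrite ltn_divLR // [X in _ < X]mulnC.
pose block v := Ordinal (div_lt v).
suff sT : [set: 'I_n] \subset block @: T.
  by rewrite -[X in X <= _]card_ord -cardsT (leq_trans (subset_leq_card sT)) //
     leq_imset_card.
apply/subsetP => q _.
have q_lt : k * q < k * n by rewrite ltn_pmul2l.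
have [v] := meetT (Ordinal q_lt); rewrite inE => /existsP[t /eqP /= vE] vT.
apply/imsetP; exists v => //; apply: val_inj => /=.
(* The block does not wrap around, so the reduction modulo [k * n] is void. *)
have lt_kn : k * q + t < k * n.
  apply: (@leq_trans (k * q.+1)); last by rewrite leq_mul2l ltn_ord orbT.
  by rewrite mulnS addnC ltn_add2r.
by rewrite vE modn_small // mulnC divnMDl // divn_small // addn0.
Qed.

Definition leaves_core N a : {ffun {set 'I_N} -> bool} :=
  [ffun e : {set 'I_N} => [exists v in e, a <= v]].

Lemma card_inj_bounded {m N a} {f : 'I_m -> 'I_N} :
  injective f -> (forall v, f v < a) -> m <= a.
Proof.
move=> f_inj f_lt; pose g v := Ordinal (f_lt v).
rewrite -[X in X <= _]card_ord -[X in _ <= X]card_ord; apply: (@leq_card _ _ g).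
by move=> u v /(congr1 val) /= /val_inj /f_inj.
Qed.

Lemma card_inj_outside {m N a} {f : 'I_m -> 'I_N} :
  injective f -> #|[set v | a <= f v]| <= N - a.
Proof.
move=> f_inj; rewrite -(card_imset _ f_inj).
have lt_sub (w : 'I_N) : a <= w -> w - a < N - a.
  by move=> aw; rewrite ltn_sub2r // (leq_ltn_trans aw).
case: (posnP (N - a)) => [Na0 | Na_gt0].
  rewrite Na0 leqn0 cards_eq0 -subset0; apply/subsetP => _ /imsetP[v + ->].
  by rewrite inE => /lt_sub; rewrite Na0.
(* The shift by [a] is injective only from [a] on, where the default of
   [insubd] is never taken. *)
pose g (w : 'I_N) := insubd (Ordinal Na_gt0) (w - a).
rewrite -[X in _ <= X]card_ord -(@card_in_imset _ _ g) ?max_card //.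
move=> _ _ /imsetP[u + ->] /imsetP[v + ->]; rewrite !inE => au av.
move/(congr1 val); rewrite !val_insubd !lt_sub // => /eqP.
by rewrite eqn_sub2rE // => /eqP /val_inj.
Qed.

(** The core being an initial segment of length [(k * n).-1], the count of the
    vertices outside it is the truncated [N - (k * n).-1], which also covers the
    [N] for which the core is everything. *)
Lemma not_arrows_tight_cycle n k N : 0 < n -> 0 < k -> N < (k + 1) * n - 1 ->
  ~~ arrows N (tight_cycle k (k * n)).
Proof.
move=> n_gt0 k_gt0 ltN; have kn_gt0 : 0 < k * n by rewrite muln_gt0 k_gt0.
have lek : k <= k * n by rewrite leq_pmulr.
apply/negP => /forallP /(_ (leaves_core N (k * n).-1)).
move=> /existsP[b /existsP[f /andP[/injectiveP f_inj /forall_inP f_edge]]].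
have colE i : [exists w in f @: consecutive k i, (k * n).-1 <= w] = b.
  have := f_edge _ (consecutive_edge i lek).
  by rewrite inE => /andP[_ /eqP <-]; rewrite ffunE.
have {f_edge} [bE | /negbTE bE] := boolP (b : bool); rewrite bE in colE.
  have := card_inj_outside (a := (k * n).-1) f_inj; apply/negP; rewrite -ltnNge.
  apply: leq_trans (_ : n <= _); last first.
    apply: tight_cycle_transversal k_gt0 _ => i.
    have /exists_inP[_ /imsetP[v vi ->] lev] := colE i.
    by exists v; rewrite // inE.
  rewrite ltn_psubLR //; move: ltN; rewrite mulnDl mul1n.
  by case: (k * n) kn_gt0 => // m _; rewrite addSn subn1.
have f_lt v : f v < (k * n).-1.
  rewrite ltnNge; apply: contraFN (colE v) => lev.
  by apply/exists_inP; exists (f v); rewrite // imset_f // mem_consecutive.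
by have := card_inj_bounded f_inj f_lt; rewrite leqNgt prednK ?leqnn.
Qed.

Theorem proposition1p2 (n k : nat) (hn : 2 <= n) (hk : 2 <= k) :
  (k + 1) * n - 1 <= ramsey (tight_cycle k (k * n)).
Proof.
rewrite /ramsey; case: ex_minnP => N arrN _; rewrite leqNgt.
by apply: contraL arrN => ltN; apply: not_arrows_tight_cycle => //; apply: ltnW.
Qed.
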